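(* Let $\mathcal{H}=\bigotimes_{i=1}^n\mathcal{H}_i$ with $\dim\mathcal{H}_i=d_i$, and let $U$ be a unitary gate on $\mathcal{H}$. Then the entangling power with respect to the $n$-party one-tangle equals $$\epsilon_1(U)=\frac{1}{2^{n-1}-1}\sum_{p|q}\epsilon_{p|q}(U),$$ where the sum is over all non-trivial unordered bipartitions $p|q$ of $\{1,\dots,n\}$, and for each such bipartition $$\epsilon_{p|q}(U)=2\left[1-\Bigg(\prod_{i=1}^n\frac{d_i}{d_i+1}\Bigg)\sum_{x'|y'}\operatorname{tr}\big[(\operatorname{tr}_{px'}|U\rangle\langle U|)^2\big]\right],$$ with the inner sum over all $2^n$ ordered bipartitions $x'|y'$ of $\{1',\dots,n'\}$ (i.e. all subsets $x'$, including $\emptyset$ and the whole set, with $y'$ the complement), and $\operatorname{tr}_{px'}$ the partial trace over the factors $\mathcal{H}_i$, $i\in p$, and $\mathcal{H}_{i'}$, $i'\in x'$.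
   Context: Let $\mathcal{H}'=\bigotimes_{i=1}^n\mathcal{H}_{i'}$ be a copy of $\mathcal{H}$ with $\dim\mathcal{H}_{i'}=d_i$. The state associated with $U$ is $|U\rangle=\frac{1}{\sqrt{d_1\cdots d_n}}\sum\langle j_1\dots j_n|U|j_{1'}\dots j_{n'}\rangle\,|j_1\dots j_n\rangle\otimes|j_{1'}\dots j_{n'}\rangle\in\mathcal{H}\otimes\mathcal{H}'$. For a pure state $|\psi\rangle\in\mathcal{H}$ and a bipartition $p|q$ of $\{1,\dots,n\}$, $\tau_{p|q}(|\psi\rangle)=2\big(1-\operatorname{tr}[(\operatorname{tr}_p|\psi\rangle\langle\psi|)^2]\big)$; the $n$-party one-tangle is $\tau_1=\frac{1}{2^{n-1}-1}\sum_{p|q}\tau_{p|q}$ (sum over non-trivial unordered bipartitions). $\epsilon_{p|q}(U)$ (resp. $\epsilon_1(U)$) is the average of $\tau_{p|q}(U|\psi_{\rm sep}\rangle)$ (resp. $\tau_1(U|\psi_{\rm sep}\rangle)$) over $|\psi_{\rm sep}\rangle=|\psi_1\rangle\otimes\cdots\otimes|\psi_n\rangle$, each $|\psi_i\rangle$ drawn independently from the unitarily invariant measure on pure states of $\mathcal{H}_i$. *)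

(* Defs.v *)
From HB Require Import structures.
From mathcomp Require Import all_boot all_order all_algebra.
From mathcomp Require Import all_classical all_reals all_analysis.
From mathcomp Require Import complex.

Set Implicit Arguments.
Unset Strict Implicit.
Unset Printing Implicit Defensive.

Import Order.TTheory GRing.Theory Num.Theory.
Local Open Scope classical_set_scope.
Local Open Scope ring_scope.

(* A system has a finite set of parties P, party i having dimension    *)
(* d i.  The computational basis of  (x)_i C^{d i}  is indexed by      *)
(* Idx d = { j | j i : 'I_(d i) }; vectors are functions Idx d -> C,   *)
(* operators are matrices Idx d -> Idx d -> C.                         *)

Definition Idx (P : finType) (d : P -> nat) := {dffun forall i : P, 'I_(d i)}.

Section Hilbert.
Variable R : realType.
Local Notation C := (R[i]).

Definition vect (P : finType) (d : P -> nat) := Idx d -> C.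
Definition oper (P : finType) (d : P -> nat) := Idx d -> Idx d -> C.

Definition ketbra (P : finType) d (psi : @vect P d) : oper d :=
  fun j k => psi j * conjc (psi k).

Definition apply (I : finType) (U : I -> I -> C) (psi : I -> C) : I -> C :=
  fun j => \sum_(k : I) U j k * psi k.

Definition unitary (I : finType) (U : I -> I -> C) : Prop :=
  (forall j k : I, \sum_(l : I) U j l * conjc (U k l) = (j == k)%:R) /\
  (forall j k : I, \sum_(l : I) conjc (U l j) * U l k = (j == k)%:R).

Definition inS (P : finType) (S : {set P}) := {i : P | i \in S}.
Definition outS (P : finType) (S : {set P}) := {i : P | i \notin S}.

Definition comb (P : finType) (d : P -> nat) (S : {set P})
  (x : Idx (fun i : inS S => d (val i))) (y : Idx (fun i : outS S => d (val i)))
  : Idx d :=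
  [ffun i : P => match @idP (i \in S) return 'I_(d i) with
                 | ReflectT h => x (exist _ i h)
                 | ReflectF h => y (exist _ i (introN idP h))
                 end].

Definition ptrace (P : finType) (d : P -> nat) (S : {set P}) (rho : oper d)
  : oper (fun i : outS S => d (val i)) :=
  fun a b => \sum_(s : Idx (fun i : inS S => d (val i)))
               rho (comb s a) (comb s b).
Arguments ptrace {P d} S rho.

Definition trsq (P : finType) (d : P -> nat) (rho : oper d) : C :=
  \sum_(a : Idx d) \sum_(b : Idx d) rho a b * rho b a.

(* tr[(tr_S |psi><psi|)^2]  (a real number) *)
Definition purity_tr (P : finType) (d : P -> nat) (S : {set P}) (psi : vect d)
  : R := complex.Re (trsq (ptrace S (ketbra psi))).

Definition tau_bip (P : finType) (d : P -> nat) (p : {set P}) (psi : vect d)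
  : R := 2 * (1 - purity_tr p psi).

(* Non-trivial unordered bipartitions p|q of {1,...,n} (parties 'I_n),
   each represented once by the block p NOT containing the first party
   (party 0); q is the complement, which contains party 0. *)
Definition bipartitions (n : nat) : {set {set 'I_n}} :=
  [set p : {set 'I_n} | (0 < #|p|)%N && [forall i in p, (val i != 0)%N]].

Definition tau_one (n : nat) (d : 'I_n -> nat) (psi : vect d) : R :=
  ((2 ^ n.-1 - 1)%:R)^-1 * \sum_(p in bipartitions n) tau_bip p psi.

Definition sep_state (P : finType) (d : P -> nat)
  (psi : forall i : P, 'I_(d i) -> C) : vect d :=
  fun j => \prod_(i : P) psi i (j i).

(* The doubled system H (x) H' : parties 'I_n + 'I_n, inl i = i, inr i = i'. *)
Definition ddim (P : finType) (d : P -> nat) : P + P -> nat :=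
  fun s => match s with inl i => d i | inr i => d i end.

Definition unprimed (P : finType) (d : P -> nat) (J : Idx (ddim d)) : Idx d :=
  [ffun i : P => (J (inl i) : 'I_(d i))].
Definition primed (P : finType) (d : P -> nat) (J : Idx (ddim d)) : Idx d :=
  [ffun i : P => (J (inr i) : 'I_(d i))].

Definition choi_state (P : finType) (d : P -> nat) (U : oper d) : vect (ddim d) :=
  fun J => U (unprimed J) (primed J) *
           (((Num.sqrt (\prod_(i : P) (d i)%:R : R))^-1)%:C)%C.

Definition pxset (P : finType) (p x' : {set P}) : {set P + P} :=
  (inl @: p) :|: (inr @: x').

End Hilbert.

Section Random.
Variable R : realType.
Local Notation C := (R[i]).

Definition vcoord (k : nat) (c : 'I_(k + k)) (v : 'I_k -> C) : R :=
  match fintype.split c with inl a => complex.Re (v a) | inr b => complex.Im (v b) end.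

(* Borel sigma-algebra on C^k (generated by the real coordinates) *)
Definition vec_measurable (k : nat) : set (set ('I_k -> C)) :=
  g_sigma_preimage (@vcoord k).

Definition sigma_of (T : Type) (k : nat) (X : T -> 'I_k -> C) : set (set T) :=
  g_sigma_preimage (fun c => @vcoord k c \o X).

Definition sqnorm (k : nat) (v : 'I_k -> C) : R :=
  \sum_(a < k) (complex.Re (v a) ^+ 2 + complex.Im (v a) ^+ 2).

Definition random_pure_states (dT : measure_display) (T : measurableType dT)
  (Pr : probability T R) (n : nat) (d : 'I_n -> nat)
  (psi : forall i : 'I_n, T -> 'I_(d i) -> C) : Prop :=
  [/\ (forall i (a : 'I_(d i)), measurable_fun setT (fun t => complex.Re (psi i t a)) /\
                                measurable_fun setT (fun t => complex.Im (psi i t a))),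
      (forall i t, sqnorm (psi i t) = 1),
      (forall A : 'I_n -> set T, (forall i, sigma_of (psi i) (A i)) ->
         Pr (\bigcap_(i in setT) A i) = (\prod_(i < n) Pr (A i))%E) &
      (forall i (V : 'I_(d i) -> 'I_(d i) -> C), unitary V ->
       forall B, vec_measurable B ->
         Pr (psi i @^-1` B) = Pr ((fun t => apply V (psi i t)) @^-1` B))].

Definition eps_bip (dT : measure_display) (T : measurableType dT)
  (Pr : probability T R) (n : nat) (d : 'I_n -> nat)
  (psi : forall i : 'I_n, T -> 'I_(d i) -> C) (U : @oper R _ d) (p : {set 'I_n})
  : \bar R :=
  (\int[Pr]_t (tau_bip p (apply U (sep_state (fun i => psi i t))))%:E)%E.

Definition eps_one (dT : measure_display) (T : measurableType dT)
  (Pr : probability T R) (n : nat) (d : 'I_n -> nat)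
  (psi : forall i : 'I_n, T -> 'I_(d i) -> C) (U : @oper R _ d) : \bar R :=
  (\int[Pr]_t (tau_one (apply U (sep_state (fun i => psi i t))))%:E)%E.

End Random.

(* Main.v *)
(* With Phi = U psi, expanding tr (tr_p |Phi><Phi|)^2 in the computational
   basis gives a sum of products of two entries of U, two conjugate entries,
   and, by independence, one moment E[psi_a psi_b psi_c^* psi_e^*] per party.
   Invariance under diagonal phases kills the moments with {a,b} <> {c,e} as
   multisets; invariance under one rotation in each coordinate plane gives
   E|psi_a|^4 = 2 E|psi_a psi_b|^2, and normalisation then yields
   ([a=c][b=e] + [a=e][b=c]) / (d (d+1)).  Expanding the product over the
   parties of these two-term sums produces a sum over subsets x', whose
   summand is the purity of tr_{p x'} |U><U| up to the factor (d_1...d_n)^2. *)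
Require Import Defs.
From HB Require Import structures.
From mathcomp Require Import all_boot all_order all_algebra.
From mathcomp Require Import all_classical all_reals all_analysis.
From mathcomp Require Import measurable_realfun fsbigop.
From mathcomp Require Import complex.
From mathcomp Require Import ring lra.

Set Implicit Arguments.
Unset Strict Implicit.
Unset Printing Implicit Defensive.

Import Order.TTheory GRing.Theory Num.Theory.
Import numFieldNormedType.Exports.
Local Open Scope classical_set_scope.
Local Open Scope ring_scope.

(** * Expectations of products of independent real random variables *)

Section Independence.
Context (R : realType) (dT : measure_display) (T : measurableType dT).
Variable P : probability T R.
Import HBNNSimple.

(** By linearity the hypothesis extends from indicators to simple functions of [X], and monotone
    convergence, available since both factors are nonnegative, extends it to [X]. *)
Lemma integral_mul_of_indicator (X G : T -> R) (c : R) :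
    measurable_fun setT X -> measurable_fun setT G ->
    (forall t, 0 <= X t) -> (forall t, 0 <= G t) ->
    (forall B : set R, measurable B ->
      \int[P]_t (\1_B (X t) * G t)%:E = c%:E * P (X @^-1` B))%E ->
  (\int[P]_t (X t * G t)%:E = c%:E * \int[P]_t (X t)%:E)%E.
Proof.
move=> mX mG X0 G0 H.
(* The absolute value is nonnegative on the whole line, as the approximation by simple functions
   asks, and is the identity on the values of [X]. *)
pose f : R -> \bar R := fun x => `|x|%:E.
have mf : measurable_fun setT f.
  by apply/measurable_EFinP; exact: normr_measurable.
pose s := nnsfun_approx measurableT mf.
have sX t : EFin \o (fun n => s n (X t)) @ \oo --> (X t)%:E.
  rewrite -[X t in X in _ --> X]ger0_norm//.
  exact: (cvg_nnsfun_approx measurableT mf (fun x _ => normr_ge0 x : (0 <= f x)%E)).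
have msX n : measurable_fun setT (fun t => s n (X t)).
  exact: measurableT_comp.
have nd t : {homo (fun n => (s n (X t))) : n m / (n <= m)%N >-> (n <= m)}.
  by move=> n m nm; exact/lefP/nd_nnsfun_approx.
have lim1 : ((fun n => \int[P]_t (s n (X t))%:E) @ \oo --> \int[P]_t (X t)%:E)%E.
  rewrite [X in _ --> X](_ : _ = \int[P]_t limn (fun n => (s n (X t))%:E))%E; last first.
    by apply: eq_integral => t _; apply/esym/cvg_lim => //; exact: sX.
  apply: cvg_monotone_convergence => //.
  - by move=> n; exact/measurable_EFinP.
  - by move=> n t _; rewrite lee_fin.
  - by move=> t _ n m nm; rewrite lee_fin; exact: nd.
have lim2 : ((fun n => \int[P]_t (s n (X t) * G t)%:E) @ \oo -->
             \int[P]_t (X t * G t)%:E)%E.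
  rewrite [X in _ --> X](_ : _ = \int[P]_t limn (fun n => (s n (X t) * G t)%:E))%E; last first.
    apply: eq_integral => t _; apply/esym/cvg_lim => //.
    under eq_fun do rewrite EFinM.
    by rewrite EFinM; apply: cvgeZr => //; exact: sX.
  apply: cvg_monotone_convergence => //.
  - by move=> n; apply/measurable_EFinP; exact: measurable_funM.
  - by move=> n t _; rewrite lee_fin mulr_ge0.
  - by move=> t _ n m nm; rewrite lee_fin ler_wpM2r//; exact: nd.
have msy n (y : R) : measurable (s n @^-1` [set y]).
  by rewrite -[X in measurable X]setTI; exact: measurable_funP.
have mi n (y : R) : measurable_fun setT (fun t => \1_(s n @^-1` [set y]) (X t) : R).
  by apply: measurableT_comp => //; exact: measurable_indic.
have y0 n (y x : R) : 0 <= y * \1_(s n @^-1` [set y]) x.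
  rewrite indicE; case: (boolP (x \in _)) => [/set_mem /= <-|_]; last by rewrite mulr0.
  by rewrite mulr1.
(* Stated for a general weight [K]: it is applied to [G] with constant [c], and to the weight 1 with
   constant 1. *)
have step n (K : T -> R) (k : R) : measurable_fun setT K -> (forall t, 0 <= K t) ->
    (forall B : set R, measurable B ->
      \int[P]_t (\1_B (X t) * K t)%:E = k%:E * P (X @^-1` B))%E ->
    (\int[P]_t (s n (X t) * K t)%:E =
     \sum_(y \in range (s n)) (y%:E * (k%:E * P (X @^-1` (s n @^-1` [set y])))))%E.
  move=> mK K0 HK.
  under eq_integral do rewrite fimfunE mulr_fsuml -fsumEFin//.
  rewrite ge0_integral_fsum//; first last.
  - by move=> y t _; rewrite lee_fin mulr_ge0//; exact: y0.
  - move=> y; apply/measurable_EFinP; apply: measurable_funM => //.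
    by apply: measurable_funM => //; exact: mi.
  apply: eq_fsbigr => y /set_mem yr.
  under eq_integral do rewrite -mulrA EFinM.
  rewrite ge0_integralZl_EFin//.
  - by rewrite HK.
  - by move=> t _; rewrite lee_fin mulr_ge0.
  - by apply/measurable_EFinP; apply: measurable_funM => //; exact: mi.
  - by case: yr => x _ <-.
have stepG n : (\int[P]_t (s n (X t) * G t)%:E = c%:E * \int[P]_t (s n (X t))%:E)%E.
  rewrite (step n G c)//.
  under [in RHS]eq_integral do rewrite -[s n _]mulr1.
  rewrite (step n (fun=> 1) 1)//; last first.
    move=> B mB; under eq_integral do rewrite mulr1.
    by rewrite mul1e (integral_indic P measurableT (A := X @^-1` B)) ?setIT// -[X @^-1` B]setTI; exact: mX.
  rewrite ge0_mule_fsumr.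
    by apply: eq_fsbigr => y _; rewrite mul1e muleCA.
  (* Distributivity over an extended-real sum asks for nonnegative terms; for [y < 0] the level set
     of the nonnegative [s n] is empty, so its term is 0. *)
  move=> y; rewrite mul1e; apply: (mulemu_ge0 (fun y => X @^-1` (s n @^-1` [set y]))) => y0'.
  by rewrite -subset0 => t /= ty; move: y0'; rewrite -ty ltNge fun_ge0.
move: lim2; under eq_fun do rewrite stepG.
move=> lim2.
apply: (cvg_unique _ lim2) => //.
exact: cvgeZl.
Qed.

Lemma integrable_bounded (f : T -> R) (M : R) :
  measurable_fun setT f -> (forall t, `|f t| <= M) ->
  P.-integrable setT (EFin \o f).
Proof.
move=> mf fM; apply: measurable_bounded_integrable => //.
  by rewrite (le_lt_trans (probability_le1 P measurableT))// ltry.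
exists M; split; first exact: num_real.
by move=> x Mx t _ /=; rewrite (le_trans (fM t))// ltW.
Qed.

(** Indicators are turned into the variables [X i] one at a time. With indicators only, the claim is
    independence; each replacement is [integral_mul_of_indicator], whose premise is the induction
    hypothesis with one set of the family changed. The induction therefore quantifies over all
    families [B]. *)
Lemma integral_prod_indep n (X : 'I_n -> T -> R) (M : R) :
    (forall i, measurable_fun setT (X i)) ->
    (forall i t, 0 <= X i t <= M) ->
    (forall B : 'I_n -> set R, (forall i, measurable (B i)) ->
      P (\bigcap_(i in setT) X i @^-1` B i) = \prod_(i < n) P (X i @^-1` B i))%E ->
  \int[P]_t (\prod_(i < n) X i t) = \prod_(i < n) \int[P]_t (X i t).
Proof.
move=> mX X0 indep.
(* hybrid family: the first [k] factors are [X i], the others indicators *)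
pose h k (B : 'I_n -> set R) (i : 'I_n) : T -> R :=
  if (i < k)%N then X i else fun t => \1_(B i) (X i t).
have mh k B i : (forall i, measurable (B i)) -> measurable_fun setT (h k B i).
  move=> mB; rewrite /h; case: ifP => // _.
  by apply: measurableT_comp => //; exact: measurable_indic.
have h0 k B i t : 0 <= h k B i t <= Num.max M 1.
  rewrite /h; case: ifP => [_|_]; first by have /andP[-> XM] := X0 i t; rewrite (le_trans XM)//= le_max lexx.
  by rewrite indicE ler0n /= le_max; apply/orP; right; case: (_ \in _).
have hM k B i t : 0 <= h k B i t by case/andP: (h0 k B i t).
have inth k B i : (forall i, measurable (B i)) -> P.-integrable setT (EFin \o h k B i).
  move=> mB; apply: (@integrable_bounded _ (Num.max M 1)); first exact: mh.
  by move=> t; have /andP[h00 h1] := h0 k B i t; rewrite ger0_norm.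
suff H k : (k <= n)%N -> forall B, (forall i, measurable (B i)) ->
    (\int[P]_t (\prod_(i < n) h k B i t)%:E = (\prod_(i < n) \int[P]_t (h k B i t))%:E)%E.
  (* At [k = n] every factor is [X i]. *)
  have hn i : h n (fun=> setT) i = X i by rewrite /h ltn_ord.
  have := H n (leqnn n) (fun=> setT) (fun=> measurableT).
  rewrite (eq_bigr _ (fun i _ => congr1 (fun f => \int[P]_t f t) (hn i))).
  rewrite (_ : (fun t => (\prod_(i < n) h n (fun=> setT) i t)%:E) =
               (fun t => (\prod_(i < n) X i t)%:E)); last first.
    by apply/funext => t; congr EFin; apply: eq_bigr => i _; rewrite hn.
  by move=> e; rewrite [LHS]/Rintegral e.
elim: k => [_ B mB|k IH kn B mB].
  rewrite /h /=.
  have mXB i : measurable (X i @^-1` B i).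
    by rewrite -[X in measurable X]setTI; exact: mX.
  (* A product of indicators is the indicator of the intersection. *)
  transitivity (P (\bigcap_(i in setT) X i @^-1` B i)).
    rewrite -[X in P X]setIT -integral_indic//; last first.
      by apply: fin_bigcap_measurable => //; exact: finite_finset.
    apply: eq_integral => t _; congr EFin.
    rewrite indicE; case: (boolP (_ \in _)) => [/set_mem tB|].
      by rewrite big1// => i _; rewrite indicE mem_set//; exact: tB.
    rewrite notin_setE => tB; apply/eqP/prodf_eq0.
    have [i nB] : exists i, ~ B i (X i t).
      by apply/existsNP => tB'; apply: tB => i _; exact: tB'.
    by exists i => //; rewrite indicE memNset.
  rewrite indep// -prodEFin; apply: eq_bigr => i _.
  rewrite /Rintegral fineK.
    by rewrite (integral_indic P measurableT (A := X i @^-1` B i)) ?setIT.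
  apply: integrable_fin_num => //.
  exact: (inth 0 B i mB).
pose i0 := Ordinal kn.
pose G t := \prod_(i < n | i != i0) h k B i t.
pose c := \prod_(i < n | i != i0) \int[P]_t (h k B i t).
have hS i : i != i0 -> h k.+1 B i = h k B i.
  move=> ii0; rewrite /h ltnS leq_eqVlt.
  by move: ii0; rewrite -(inj_eq val_inj) /= => /negbTE ->.
have hi0 : h k.+1 B i0 = X i0 by rewrite /h /= ltnSn.
have := @integral_mul_of_indicator (X i0) G c.
have -> : (fun t => (X i0 t * G t)%:E) = (fun t => (\prod_(i < n) h k.+1 B i t)%:E).
  apply/funext => t; rewrite (bigD1 i0)//= hi0; congr (_ * _)%:E.
  by apply: eq_bigr => i ii0; rewrite hS.
move=> ->.
- rewrite (bigD1 i0)//= EFinM muleC; congr (_ * _)%E.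
    by rewrite /Rintegral fineK ?hi0//; apply: integrable_fin_num => //; rewrite -hi0; exact: inth.
  by congr EFin; apply: eq_bigr => i ii0; rewrite hS.
- exact: mX.
- rewrite /G; under eq_fun do rewrite -big_filter.
  by apply: measurable_prod => i _; exact: mh.
- by move=> t; case/andP: (X0 i0 t).
- by move=> t; apply: prodr_ge0.
move=> B' mB'.
(* In [h k] the factor of index [k] is still an indicator, so its set may be chosen to be the test
   set [B']. *)
pose B2 i := if i == i0 then B' else B i.
have mB2 i : measurable (B2 i) by rewrite /B2; case: ifP.
have hB2 i : i != i0 -> h k B2 i = h k B i by move=> /negbTE ii0; rewrite /h /B2 ii0.
have hB20 : h k B2 i0 = fun t => \1_B' (X i0 t) by rewrite /h /B2 eqxx /= ltnn.
have := IH (ltnW kn) B2 mB2.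
have -> : (fun t => (\prod_(i < n) h k B2 i t)%:E) = (fun t => (\1_B' (X i0 t) * G t)%:E).
  apply/funext => t; rewrite (bigD1 i0)//= hB20; congr (_ * _)%:E.
  by apply: eq_bigr => i ii0; rewrite hB2.
move=> ->; rewrite (bigD1 i0)//= EFinM muleC; congr (_ * _)%E.
  by congr EFin; apply: eq_bigr => i ii0; rewrite hB2.
have mXB : measurable (X i0 @^-1` B').
  by rewrite -[X in measurable X]setTI; exact: mX.
rewrite /Rintegral fineK.
  by rewrite hB20 (integral_indic P measurableT (A := X i0 @^-1` B')) ?setIT.
by apply: integrable_fin_num => //; exact: inth.
Qed.
End Independence.

(** * Real and imaginary parts of complex numbers *)

Section ComplexAlgebra.
Variable R : realType.
Implicit Types x y : R[i].

Lemma ReD x y : complex.Re (x + y) = complex.Re x + complex.Re y.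
Proof. by case: x; case: y. Qed.
Lemma ImD x y : complex.Im (x + y) = complex.Im x + complex.Im y.
Proof. by case: x; case: y. Qed.
Lemma ReM x y :
  complex.Re (x * y) = complex.Re x * complex.Re y - complex.Im x * complex.Im y.
Proof. by case: x; case: y. Qed.
Lemma ImM x y :
  complex.Im (x * y) = complex.Re x * complex.Im y + complex.Im x * complex.Re y.
Proof. by case: x; case: y. Qed.

Lemma normr_Re x (M : R) : `|x| <= M%:C%C -> `|complex.Re x| <= M.
Proof. by move=> xM; rewrite -lecR (le_trans (normc_ge_Re x)). Qed.
Lemma normr_Im x (M : R) : `|x| <= M%:C%C -> `|complex.Im x| <= M.
Proof.
(* Multiplication by ['i] preserves the modulus and turns the imaginary part, up to sign, into the
   real part. *)
move=> xM; have := @normr_Re (x * 'i%C) M.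
rewrite ReiNIm normrN; apply; rewrite normrM (_ : `|'i%C| = 1) ?mulr1//.
by rewrite normc_def /= expr0n expr1n add0r sqrtr1.
Qed.
End ComplexAlgebra.

(** * Coordinatewise measurability of complex functions *)

Section ComplexMeasurable.
Variables (R : realType) (d : measure_display) (W : measurableType d).
Implicit Types f g : W -> R[i].

Definition cmeasurable f :=
  measurable_fun setT (fun w => complex.Re (f w)) /\
  measurable_fun setT (fun w => complex.Im (f w)).

Lemma cmeasurable_cst (c : R[i]) : cmeasurable (fun=> c).
Proof. by split; exact: measurable_cst. Qed.

Lemma cmeasurableD f g :
  cmeasurable f -> cmeasurable g -> cmeasurable (fun w => f w + g w).
Proof.
move=> [f1 f2] [g1 g2]; split.
  by under eq_fun do rewrite ReD; exact: measurable_funD.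
by under eq_fun do rewrite ImD; exact: measurable_funD.
Qed.

Lemma cmeasurableM f g :
  cmeasurable f -> cmeasurable g -> cmeasurable (fun w => f w * g w).
Proof.
move=> [f1 f2] [g1 g2]; split.
  by under eq_fun do rewrite ReM; apply: measurable_funB; exact: measurable_funM.
by under eq_fun do rewrite ImM; apply: measurable_funD; exact: measurable_funM.
Qed.

Lemma cmeasurable_conj f : cmeasurable f -> cmeasurable (fun w => conjc (f w)).
Proof.
move=> [f1 f2]; split.
  by rewrite [X in measurable_fun _ X](_ : _ = fun w => complex.Re (f w))//; apply/funext => w; case: (f w).
rewrite [X in measurable_fun _ X](_ : _ = fun w => - complex.Im (f w)).
  exact: measurable_funN.
by apply/funext => w; case: (f w).
Qed.
End ComplexMeasurable.

(** * Expectations of bounded complex random variables *)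

Section ComplexExpectation.
Context (R : realType) (dT : measure_display) (T : measurableType dT).
Variable P : probability T R.
Implicit Types f g : T -> R[i].

(** Boundedness implies integrability under a probability and, unlike integrability, is stable under
    products. *)
Definition cbounded_rv f :=
  cmeasurable f /\ exists M : R, forall t, `|f t| <= M%:C%C.

Definition cexpect f : R[i] :=
  Complex (\int[P]_t complex.Re (f t)) (\int[P]_t complex.Im (f t)).

Lemma cbounded_rv_cst (c : R[i]) : cbounded_rv (fun=> c).
Proof.
split; first exact: cmeasurable_cst.
by exists (complex.Re `|c|) => _; rewrite RRe_real// normr_real.
Qed.

Lemma cbounded_rvD f g :
  cbounded_rv f -> cbounded_rv g -> cbounded_rv (fun t => f t + g t).
Proof.
move=> [mf [M fM]] [mg [N gN]]; split; first exact: cmeasurableD.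
by exists (M + N) => t; rewrite (le_trans (ler_normD _ _))// rmorphD /= lerD.
Qed.

Lemma cbounded_rvM f g :
  cbounded_rv f -> cbounded_rv g -> cbounded_rv (fun t => f t * g t).
Proof.
move=> [mf [M fM]] [mg [N gN]]; split; first exact: cmeasurableM.
by exists (M * N) => t; rewrite normrM rmorphM /= ler_pM.
Qed.

Lemma cbounded_rv_conj f : cbounded_rv f -> cbounded_rv (fun t => conjc (f t)).
Proof.
move=> [mf [M fM]]; split; first exact: cmeasurable_conj.
by exists M => t; rewrite normcJ.
Qed.

Lemma cbounded_rv_sum I (s : seq I) (Q : pred I) (F : I -> T -> R[i]) :
  (forall i, cbounded_rv (F i)) -> cbounded_rv (fun t => \sum_(i <- s | Q i) F i t).
Proof.
move=> mF; elim: s => [|i s IH].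
  by under eq_fun do rewrite big_nil; exact: cbounded_rv_cst.
under eq_fun do rewrite big_cons.
by case: (Q i) => //; exact: cbounded_rvD.
Qed.

Lemma cbounded_rv_prod I (s : seq I) (Q : pred I) (F : I -> T -> R[i]) :
  (forall i, cbounded_rv (F i)) -> cbounded_rv (fun t => \prod_(i <- s | Q i) F i t).
Proof.
move=> mF; elim: s => [|i s IH].
  by under eq_fun do rewrite big_nil; exact: cbounded_rv_cst.
under eq_fun do rewrite big_cons.
by case: (Q i) => //; exact: cbounded_rvM.
Qed.

Lemma integrable_Re f : cbounded_rv f ->
  P.-integrable setT (fun t => (complex.Re (f t))%:E).
Proof.
move=> [[mR _] [M fM]]; apply: (@integrable_bounded _ _ _ P _ M) => // t.
exact: normr_Re.
Qed.

Lemma integrable_Im f : cbounded_rv f ->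
  P.-integrable setT (fun t => (complex.Im (f t))%:E).
Proof.
move=> [[_ mI] [M fM]]; apply: (@integrable_bounded _ _ _ P _ M) => // t.
exact: normr_Im.
Qed.

Lemma cexpect_cst c : cexpect (fun=> c) = c.
Proof.
have P1 : fine (P setT) = 1 by rewrite [X in fine X](@probability_setT _ _ _ P).
rewrite /cexpect !Rintegral_cst// P1 !mulr1.
by case: c.
Qed.

Lemma cexpectD f g : cbounded_rv f -> cbounded_rv g ->
  cexpect (fun t => f t + g t) = cexpect f + cexpect g.
Proof.
move=> bf bg; apply/eqP; rewrite eq_complex /=.
apply/andP; split; apply/eqP.
  rewrite -RintegralD//; [|exact: integrable_Re|exact: integrable_Re].
  by apply: eq_Rintegral => t _; rewrite ReD.
rewrite -RintegralD//; [|exact: integrable_Im|exact: integrable_Im].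
by apply: eq_Rintegral => t _; rewrite ImD.
Qed.

Lemma cexpectZ c f : cbounded_rv f ->
  cexpect (fun t => c * f t) = c * cexpect f.
Proof.
move=> bf; apply/eqP; rewrite eq_complex /=.
have iR := integrable_Re bf; have iI := integrable_Im bf.
have iZR r : P.-integrable setT (EFin \o (fun t => r * complex.Re (f t))).
  by rewrite /comp; under eq_fun do rewrite EFinM; exact: integrableZl.
have iZI r : P.-integrable setT (EFin \o (fun t => r * complex.Im (f t))).
  by rewrite /comp; under eq_fun do rewrite EFinM; exact: integrableZl.
apply/andP; split; apply/eqP.
  rewrite ReM /= -!RintegralZl// -RintegralB//.
  by apply: eq_Rintegral => t _; rewrite ReM.
rewrite ImM /= -!RintegralZl// -RintegralD//.
by apply: eq_Rintegral => t _; rewrite ImM.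
Qed.

Lemma cexpect_sum I (s : seq I) (Q : pred I) (F : I -> T -> R[i]) :
  (forall i, cbounded_rv (F i)) ->
  cexpect (fun t => \sum_(i <- s | Q i) F i t) = \sum_(i <- s | Q i) cexpect (F i).
Proof.
move=> mF; elim: s => [|i s IH].
  by under eq_fun do rewrite big_nil; rewrite cexpect_cst big_nil.
under eq_fun do rewrite big_cons.
rewrite big_cons; case: (Q i) => //; rewrite -IH cexpectD//.
exact: cbounded_rv_sum.
Qed.

Lemma cexpect_real (X : T -> R) :
  cexpect (fun t => (X t)%:C%C) = (\int[P]_t X t)%:C%C.
Proof.
by rewrite /cexpect /= Rintegral_cst// mul0r.
Qed.

(** Measurability of [F i] for the sigma-algebra generated by [G i] places the preimages under its
    real and imaginary parts among the sets whose independence is assumed. *)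
Lemma cexpect_prod_indep n (G : 'I_n -> set (set T)) (F : 'I_n -> T -> R[i]) (M : R) :
    0 <= M ->
    (forall i, cmeasurable (F i)) ->
    (forall i, cmeasurable (F i : g_sigma_algebraType (G i) -> R[i])) ->
    (forall i t, `|F i t| <= M%:C%C) ->
    (forall A : 'I_n -> set T, (forall i, <<s G i >> (A i)) ->
      P (\bigcap_(i in setT) A i) = \prod_(i < n) P (A i))%E ->
  cexpect (fun t => \prod_(i < n) F i t) = \prod_(i < n) cexpect (F i).
Proof.
move=> M0 mF sF FM indep.
(* [F i = (M + Re F i) + 'i (M + Im F i) - M (1 + 'i)] reduces, by
   multilinearity, to nonnegative factors *)
pose X i (c : 'I_3) t : R :=
  if c == 0 :> nat then M + complex.Re (F i t)
  else if c == 1 :> nat then M + complex.Im (F i t) else 1.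
pose w (c : 'I_3) : R[i] :=
  if c == 0 :> nat then 1 else if c == 1 :> nat then 'i%C else - (Complex M M).
have FE i t : F i t = \sum_(c < 3) w c * (X i c t)%:C%C.
  rewrite 3!big_ord_recr big_ord0 /w /X /=.
  case: (F i t) => a b /=; apply/eqP; rewrite eq_complex /=.
  by apply/andP; split; apply/eqP; ring.
(* The shifted parts lie in [[0, 2 M]] and the third variable is 1, so [2 M + 1] bounds all
   three. *)
have X0 i c t : 0 <= X i c t <= 2 * M + 1.
  have := normr_Re (FM i t); have := normr_Im (FM i t).
  by rewrite !ler_norml /X => /andP[? ?] /andP[? ?]; do 2?case: ifP => _; apply/andP; split; lra.
have mX i c : measurable_fun setT (X i c).
  have [m1 m2] := mF i; rewrite /X.
  by case: eqP => _; [|case: eqP => _] => //; exact: measurable_funD.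
have sX i c : measurable_fun setT (X i c : g_sigma_algebraType (G i) -> R).
  have [m1 m2] := sF i; rewrite /X.
  by case: eqP => _; [|case: eqP => _] => //; exact: measurable_funD.
have bX i c : cbounded_rv (fun t => (X i c t)%:C%C).
  split; first by split; [exact: mX|exact: measurable_cst].
  exists (2 * M + 1) => t; have /andP[x0 x1] := X0 i c t.
  by rewrite ger0_norm ?ler0c// lecR.
(* The product of three-term sums is expanded over all choices [f] of one term per factor. *)
transitivity (cexpect (fun t => \sum_(f : {ffun 'I_n -> 'I_3})
    (\prod_(i < n) w (f i)) * \prod_(i < n) (X i (f i) t)%:C%C)).
  congr cexpect; apply/funext => t.
  under eq_bigr do rewrite FE.
  rewrite bigA_distr_bigA /=; apply: eq_bigr => f _.
  by rewrite big_split.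
rewrite cexpect_sum; last first.
  by move=> f; apply: cbounded_rvM; [exact: cbounded_rv_cst|exact: cbounded_rv_prod].
transitivity (\prod_(i < n) \sum_(c < 3) w c * cexpect (fun t => (X i c t)%:C%C)).
  rewrite bigA_distr_bigA /=; apply: eq_bigr => f _.
  rewrite cexpectZ; last exact: cbounded_rv_prod.
  rewrite big_split /=; congr (_ * _).
  under eq_fun do rewrite -rmorph_prod.
  rewrite cexpect_real (@integral_prod_indep _ _ _ P _ _ (2 * M + 1))//.
    by rewrite rmorph_prod /=; apply: eq_bigr => i _; rewrite cexpect_real.
  move=> B mB; apply: indep => i.
  have := sX i (f i) measurableT (B i) (mB i).
  by rewrite setTI.
apply: eq_bigr => i _.
under [X in _ = cexpect X]eq_fun do rewrite FE.
rewrite cexpect_sum; last by move=> c; apply: cbounded_rvM => //; exact: cbounded_rv_cst.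
by apply: eq_bigr => c _; rewrite cexpectZ.
Qed.
End ComplexExpectation.

(** * Fourth-degree monomials of a state, and the test unitaries *)

Section PureState.
Variable R : realType.
Local Notation C := R[i].

(* [vec_measurable] and [sigma_of X] are, by conversion, the sigma-algebras
   generated by [coord_system id] and [coord_system X]. *)
Definition coord_system (W : Type) (k : nat) (v : W -> 'I_k -> C) : set (set W) :=
  \big[setU/set0]_(c < k + k)
    preimage_set_system setT (@vcoord R k c \o v) measurable.

Lemma cmeasurable_coord (W : pointedType) (k : nat) (v : W -> 'I_k -> C) (a : 'I_k) :
  cmeasurable (fun w : g_sigma_algebraType (coord_system v) => v w a).
Proof.
suff H c : measurable_fun setT
    (fun w : g_sigma_algebraType (coord_system v) => vcoord c (v w)).
  split.
    rewrite [X in measurable_fun _ X](_ : _ = fun w => vcoord (lshift k a) (v w)); first exact: H.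
    by apply/funext => w; rewrite /vcoord (unsplitK (inl a)).
  rewrite [X in measurable_fun _ X](_ : _ = fun w => vcoord (rshift k a) (v w)); first exact: H.
  by apply/funext => w; rewrite /vcoord (unsplitK (inr a)).
move=> _ B mB; rewrite setTI; apply: sub_sigma_algebra.
by rewrite /coord_system (bigD1 c)//=; left; exists B => //; rewrite setTI.
Qed.

Lemma normc_coord_le1 (k : nat) (v : 'I_k -> C) (a : 'I_k) :
  sqnorm v = 1 -> `|v a| <= 1%:C%C.
Proof.
move=> v1; rewrite normc_def lecR -[leRHS]sqrtr1 ler_wsqrtr// -v1 /sqnorm (bigD1 a)//=.
by rewrite lerDl sumr_ge0// => i _; rewrite addr_ge0// sqr_ge0.
Qed.

(** The monomial out of which purities are built. The index type is arbitrary, so that it serves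
    both for one party and for the whole system. *)
Definition moment4 (I : finType) (a b c e : I) (v : I -> C) : C :=
  v a * (v b * (conjc (v c) * conjc (v e))).

(** The sums are nested, each coefficient in front of the next sum, so that expectations and
    Kronecker deltas can be handled one index at a time. *)
Lemma moment4_apply (I : finType) (V : I -> I -> C) (a b c e : I) v :
  moment4 a b c e (apply V v) =
    \sum_a' V a a' * (\sum_b' V b b' * (\sum_c' conjc (V c c') *
      (\sum_e' conjc (V e e') * moment4 a' b' c' e' v))).
Proof.
rewrite /moment4 {1}/apply mulr_suml; apply: eq_bigr => a' _.
rewrite -mulrA; congr (_ * _).
rewrite {1}/apply mulr_suml mulr_sumr; apply: eq_bigr => b' _.
rewrite -mulrA mulrCA; congr (_ * _).
rewrite {1}/apply rmorph_sum mulr_suml !mulr_sumr; apply: eq_bigr => c' _.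
rewrite rmorphM /= -mulrA [X in _ * X]mulrCA mulrCA; congr (_ * _).
rewrite {1}/apply rmorph_sum !mulr_sumr; apply: eq_bigr => e' _.
by rewrite rmorphM /=; ring.
Qed.

Lemma sum_delta (I : finType) (a : I) (f : I -> C) :
  \sum_l (l == a)%:R * f l = f a.
Proof.
rewrite (bigD1 a)//= eqxx mul1r big1 ?addr0// => l /negbTE ->.
by rewrite mul0r.
Qed.

(** The single phase ['i] suffices: with [a] well chosen, an unbalanced monomial is multiplied by
    ['i] or -1, never by 1. *)
Definition phase (k : nat) (a j : 'I_k) : C := if j == a then 'i%C else 1.
Definition phase_gate (k : nat) (a j l : 'I_k) : C := phase a j * (l == j)%:R.

Lemma phaseJ (k : nat) (a j : 'I_k) : phase a j * conjc (phase a j) = 1.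
Proof.
by rewrite /phase; case: eqP => _; apply/eqP; rewrite eq_complex /=; apply/andP; split; apply/eqP; ring.
Qed.

Lemma unitary_phase_gate (k : nat) (a : 'I_k) : unitary (phase_gate a).
Proof.
split=> j l; rewrite /phase_gate.
  under eq_bigr do rewrite [_ * _%:R]mulrC -mulrA.
  rewrite sum_delta rmorphM rmorph_nat /= mulrA.
  by case: eqP => [->|_]; rewrite ?phaseJ ?mul1r// mulr0.
under eq_bigr => m _ do rewrite rmorphM rmorph_nat /= [j == m]eq_sym [X in X * _]mulrC -mulrA.
rewrite sum_delta mulrA [conjc _ * _]mulrC phaseJ mul1r.
by rewrite eq_sym.
Qed.

(* the 3-4-5 triangle gives a rotation with rational entries *)
Definition rotation (k : nat) (a b : 'I_k) (s : C) (j l : 'I_k) : C :=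
  if j == a then 3 / 5 * (l == a)%:R + s * (l == b)%:R
  else if j == b then 3 / 5 * (l == b)%:R - s * (l == a)%:R
  else (l == j)%:R.

Lemma sum_rotation (k : nat) (a b : 'I_k) (s : C) (j : 'I_k) (f : 'I_k -> C) :
  \sum_l rotation a b s j l * f l =
    if j == a then 3 / 5 * f a + s * f b
    else if j == b then 3 / 5 * f b - s * f a else f j.
Proof.
rewrite /rotation; move: (3 / 5) => r; case: ifP => _.
  under eq_bigr do rewrite mulrDl -!mulrA.
  by rewrite big_split /= -!mulr_sumr !sum_delta.
case: ifP => _; last by rewrite sum_delta.
under eq_bigr do rewrite mulrBl -!mulrA.
by rewrite sumrB -!mulr_sumr !sum_delta.
Qed.

Lemma rotationJ (k : nat) (a b : 'I_k) (s : C) (j l : 'I_k) :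
  conjc s = s -> conjc (rotation a b s j l) = rotation a b s j l.
Proof.
move=> sJ; rewrite /rotation; case: ifP => _.
  by rewrite rmorphD !rmorphM fmorphV !rmorph_nat /= sJ.
case: ifP => _; last by rewrite rmorph_nat.
by rewrite rmorphB !rmorphM fmorphV !rmorph_nat /= sJ.
Qed.

(** Transposing a plane rotation reverses its angle; this reduces orthonormality of columns to that
    of rows. *)
Lemma rotation_tr (k : nat) (a b : 'I_k) (s : C) (j l : 'I_k) :
  a != b -> rotation a b s j l = rotation a b (- s) l j.
Proof.
move=> ab; have /negbTE ba : b != a by rewrite eq_sym.
move/negbTE: ab => ab.
rewrite /rotation; have [->|ja] := eqVneq j a; have [->|la] := eqVneq l a;
  rewrite ?eqxx ?ab ?ba ?(negbTE ja) ?(negbTE la);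
  have [jb|jb] := eqVneq j b; have [lb|lb] := eqVneq l b;
  rewrite ?jb ?lb ?eqxx ?ab ?ba ?(negbTE ja) ?(negbTE la) ?(negbTE jb) ?(negbTE lb);
  rewrite ?[a == l]eq_sym ?[a == j]eq_sym ?[b == l]eq_sym ?[b == j]eq_sym
     ?ab ?ba ?(negbTE ja) ?(negbTE la) ?(negbTE jb) ?(negbTE lb) /=;
  try ring.
by rewrite eq_sym.
Qed.

(** Only the square of [s] is prescribed, so row orthonormality holds for [s] and [- s] alike, and
    the rows for [- s] are the columns for [s]. *)
Lemma unitary_rotation (k : nat) (a b : 'I_k) (s : C) :
  a != b -> conjc s = s -> s ^+ 2 = (4 / 5) ^+ 2 -> unitary (rotation a b s).
Proof.
move=> ab.
have H (s' : C) : conjc s' = s' -> s' ^+ 2 = (4 / 5) ^+ 2 -> forall j l,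
    \sum_m rotation a b s' j m * conjc (rotation a b s' l m) = (j == l)%:R.
  move=> sJ s2 j l; under eq_bigr do rewrite rotationJ//.
  have /negbTE ba : b != a by rewrite eq_sym.
  move/negbTE: ab => ab.
  rewrite sum_rotation /rotation.
  have [->|la] := eqVneq l a; [|have [->|lb] := eqVneq l b];
    (have [ja|ja] := eqVneq j a; [|have [jb|jb] := eqVneq j b]);
    rewrite ?ja ?jb ?eqxx ?ab ?ba ?(negbTE ja) ?(negbTE jb) ?(negbTE la) ?(negbTE lb)
      ?[_ == l]eq_sym ?(negbTE la) ?(negbTE lb) /=;
    (* What [ring] leaves are the two diagonal entries in the rotated plane, equal to
       [(3/5)^2 + (4/5)^2 = 1]. *)
    try ring; by transitivity ((3 / 5) ^+ 2 + s' ^+ 2 : C); [ring|rewrite s2; field].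
move=> sJ s2; split; first exact: H.
have sN : conjc (- s) = - s by rewrite rmorphN /= sJ.
move=> j l; rewrite -(H (- s) sN _ j l) ?sqrrN//.
by apply: eq_bigr => m _; rewrite !(rotation_tr s m)// !rotationJ.
Qed.
End PureState.

(** * Fourth moments of a unitarily invariant random unit vector *)

Section Moments.
Context (R : realType) (dT : measure_display) (T : measurableType dT).
Variable P : probability T R.
Local Notation C := R[i].

(** Both sides integrate the identity against the same image measure. *)
Lemma Rintegral_eq_distribution (X Y : T -> R) :
    measurable_fun setT X -> measurable_fun setT Y ->
    P.-integrable setT (EFin \o X) -> P.-integrable setT (EFin \o Y) ->
    (forall B : set R, measurable B -> P (X @^-1` B) = P (Y @^-1` B)) ->
  \int[P]_t X t = \int[P]_t Y t.
Proof.
move=> mX mY iX iY XY; rewrite /Rintegral; congr fine.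
pose X' : {RV P >-> R} := mfun_Sub (mem_set mX).
pose Y' : {RV P >-> R} := mfun_Sub (mem_set mY).
transitivity (\int[distribution P X']_y y%:E)%E.
  by rewrite integral_distribution.
transitivity (\int[distribution P Y']_y y%:E)%E.
  by apply: eq_measure_integral => B mB _; exact: XY.
by rewrite integral_distribution.
Qed.

Lemma cbounded_rvZ (w : C) (f : T -> C) :
  cbounded_rv f -> cbounded_rv (fun t => w * f t).
Proof. by move=> bf; apply: cbounded_rvM => //; exact: cbounded_rv_cst. Qed.

Lemma cexpect_lin I (s : seq I) (w : I -> C) (F : I -> T -> C) :
  (forall i, cbounded_rv (F i)) ->
  cexpect P (fun t => \sum_(i <- s) w i * F i t) = \sum_(i <- s) w i * cexpect P (F i).
Proof.
move=> bF; rewrite cexpect_sum => [|i]; last exact: cbounded_rvZ.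
by apply: eq_bigr => i _; rewrite cexpectZ.
Qed.

Lemma cbounded_rv_moment4 (I : finType) (v : T -> I -> C) a b c e :
  (forall x, cbounded_rv (fun t => v t x)) ->
  cbounded_rv (fun t => moment4 a b c e (v t)).
Proof.
move=> bv.
by do 3 (apply: cbounded_rvM; first by do ?apply: cbounded_rv_conj);
  apply: cbounded_rv_conj.
Qed.

Lemma cbounded_rv_apply (I : finType) (V : I -> I -> C) (v : T -> I -> C) a :
  (forall x, cbounded_rv (fun t => v t x)) ->
  cbounded_rv (fun t => apply V (v t) a).
Proof. by move=> bv; apply: cbounded_rv_sum => x; exact: cbounded_rvZ. Qed.

Lemma cexpect_moment4_apply (I : finType) (V : I -> I -> C) (v : T -> I -> C) a b c e :
  (forall x, cbounded_rv (fun t => v t x)) ->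
  cexpect P (fun t => moment4 a b c e (apply V (v t))) =
    \sum_a' V a a' * (\sum_b' V b b' * (\sum_c' conjc (V c c') *
      (\sum_e' conjc (V e e') * cexpect P (fun t => moment4 a' b' c' e' (v t))))).
Proof.
move=> bv.
have bE a' b' c' : cbounded_rv (fun t => \sum_e' conjc (V e e') * moment4 a' b' c' e' (v t)).
  by apply: cbounded_rv_sum => e'; apply: cbounded_rvZ; exact: cbounded_rv_moment4.
have bC a' b' : cbounded_rv (fun t => \sum_c' conjc (V c c') *
    (\sum_e' conjc (V e e') * moment4 a' b' c' e' (v t))).
  by apply: cbounded_rv_sum => c'; apply: cbounded_rvZ; exact: bE.
have bB a' : cbounded_rv (fun t => \sum_b' V b b' * (\sum_c' conjc (V c c') *
    (\sum_e' conjc (V e e') * moment4 a' b' c' e' (v t)))).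
  by apply: cbounded_rv_sum => b'; apply: cbounded_rvZ; exact: bC.
under eq_fun do rewrite moment4_apply.
rewrite cexpect_lin//; apply: eq_bigr => a' _; congr (_ * _).
rewrite cexpect_lin//; apply: eq_bigr => b' _; congr (_ * _).
rewrite cexpect_lin//; apply: eq_bigr => c' _; congr (_ * _).
by rewrite cexpect_lin// => e'; exact: cbounded_rv_moment4.
Qed.

Variables (k : nat) (psi : T -> 'I_k -> C).
Hypothesis psi_measurable : forall a, cmeasurable (fun t => psi t a).
Hypothesis psi_norm : forall t, sqnorm (psi t) = 1.
Hypothesis psi_invariant : forall V : 'I_k -> 'I_k -> C, unitary V ->
  forall B, vec_measurable B ->
    P (psi @^-1` B) = P ((fun t => apply V (psi t)) @^-1` B).

Lemma cbounded_rv_psi a : cbounded_rv (fun t => psi t a).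
Proof. by split => //; exists 1 => t; exact: normc_coord_le1. Qed.

Let m4 a b c e := cexpect P (fun t => moment4 a b c e (psi t)).

(** The monomial is a Borel function on C^k, so its expectation depends only on the law of the
    vector, which [V] preserves; the right side is the expanded moment of the transformed vector. *)
Lemma m4_unitary V a b c e : unitary V ->
  m4 a b c e = \sum_a' V a a' * (\sum_b' V b b' * (\sum_c' conjc (V c c') *
      (\sum_e' conjc (V e e') * m4 a' b' c' e'))).
Proof.
move=> uV.
have bA : cbounded_rv (fun t => moment4 a b c e (apply V (psi t))).
  by apply: cbounded_rv_moment4 => x; apply: cbounded_rv_apply; exact: cbounded_rv_psi.
rewrite -cexpect_moment4_apply; last exact: cbounded_rv_psi.
(* [W] is C^k with a base point, the structure under which [cmeasurable_coord] applies to the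
   identity map. *)
pose W : pointedType := HB.pack_for pointedType ('I_k -> C) (gen_eqMixin ('I_k -> C)) (gen_choiceMixin ('I_k -> C)) (isPointed.Build _ (fun=> 0 : C)).
have mM : cmeasurable (moment4 a b c e : g_sigma_algebraType (coord_system (@id W)) -> C).
  by do 3 (apply: cmeasurableM; first by do ?apply: cmeasurable_conj; exact: (@cmeasurable_coord R W));
    apply: cmeasurable_conj; exact: (@cmeasurable_coord R W).
have b4 := cbounded_rv_moment4 a b c e cbounded_rv_psi.
rewrite /m4 /cexpect; congr Complex.
  apply: Rintegral_eq_distribution.
  - by case: b4 => [[]].
  - by case: bA => [[]].
  - exact: integrable_Re.
  - exact: integrable_Re.
  - move=> B mB; apply: (psi_invariant uV (B := [set v | B (complex.Re (moment4 a b c e v))])).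
    by have := mM.1 measurableT _ mB; rewrite setTI.
apply: Rintegral_eq_distribution.
- by case: b4 => [[]].
- by case: bA => [[]].
- exact: integrable_Im.
- exact: integrable_Im.
- move=> B mB; apply: (psi_invariant uV (B := [set v | B (complex.Im (moment4 a b c e v))])).
  by have := mM.2 measurableT _ mB; rewrite setTI.
Qed.

Lemma m4_phase x a b c e : m4 a b c e =
  phase R x a * (phase R x b * (conjc (phase R x c) * (conjc (phase R x e) * m4 a b c e))).
Proof.
rewrite {1}(m4_unitary a b c e (unitary_phase_gate R x)) /phase_gate.
under eq_bigr do rewrite -mulrA; rewrite -mulr_sumr sum_delta; congr (_ * _).
under eq_bigr do rewrite -mulrA; rewrite -mulr_sumr sum_delta; congr (_ * _).
under eq_bigr do rewrite rmorphM rmorph_nat /= -mulrA.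
rewrite -mulr_sumr sum_delta; congr (_ * _).
under eq_bigr do rewrite rmorphM rmorph_nat /= -mulrA.
by rewrite -mulr_sumr sum_delta; congr (_ * _).
Qed.

(** A phase gate multiplies the moment by some [q] yet leaves it unchanged, so it vanishes as soon
    as [q] differs from 1. *)
Lemma m4_unbalanced a b c e :
  ~~ ((a == c) && (b == e) || (a == e) && (b == c)) -> m4 a b c e = 0.
Proof.
move=> nb.
have H (q : C) x : phase R x a * (phase R x b * (conjc (phase R x c) * conjc (phase R x e))) = q ->
    q != 1 -> m4 a b c e = 0.
  move=> <- q1; apply/eqP; move: (m4_phase x a b c e) => /eqP.
  rewrite -subr_eq0 !mulrA -[X in X - _]mul1r -mulrBl mulf_eq0 subr_eq0 eq_sym -!mulrA.
  by rewrite (negbTE q1).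
have i1 : 'i%C != 1 :> C by rewrite eq_complex /= oner_eq0 andbF.
have phx (x : 'I_k) : phase R x x = 'i%C by rewrite /phase eqxx.
have phy (x y : 'I_k) : y != x -> phase R x y = 1 by rewrite /phase => /negbTE ->.
(* If [a] matches [c] or [e], those two phases cancel and a gate at [b] leaves ['i]. Otherwise a
   gate at [a] gives -1 when [b = a] and ['i] when not. *)
have [ac|ac] := eqVneq a c.
  have eb : e != b by apply: contraNneq nb => eb; rewrite ac eb !eqxx.
  apply: (H 'i%C b) => //.
  by rewrite phx (phy b e)// conjc1 mulr1 -ac mulrCA phaseJ mulr1.
have [ae|ae] := eqVneq a e.
  have cb : c != b by apply: contraNneq nb => cb; rewrite ae cb !eqxx orbT.
  apply: (H 'i%C b) => //.
  by rewrite phx (phy b c)// conjc1 mul1r -ae mulrCA phaseJ mulr1.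
have ca : c != a by rewrite eq_sym.
have ea : e != a by rewrite eq_sym.
have [ba|ba] := eqVneq b a.
  apply: (H (-1) a); last by rewrite eqNr oner_eq0.
  by rewrite ba phx !phy// !conjc1 !mulr1 -expr2 sqr_i.
apply: (H 'i%C a) => //.
by rewrite phx !phy// !conjc1 !mulr1.
Qed.

Lemma m4_swapl a b c e : m4 a b c e = m4 b a c e.
Proof. by congr (cexpect P); apply/funext => t; rewrite /moment4; ring. Qed.

Lemma m4_swapr a b c e : m4 a b c e = m4 a b e c.
Proof. by congr (cexpect P); apply/funext => t; rewrite /moment4; ring. Qed.

Lemma m4_rotation a b s : a != b -> conjc s = s -> s ^+ 2 = (4 / 5) ^+ 2 ->
  m4 a a a a = (3 / 5) ^+ 4 * m4 a a a a + s ^+ 4 * m4 b b b b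
               + 4 * (3 / 5) ^+ 2 * s ^+ 2 * m4 a b a b.
Proof.
move=> ab sJ s2.
rewrite {1}(m4_unitary a a a a (unitary_rotation ab sJ s2)).
under eq_bigr => a' _ do under eq_bigr => b' _ do under eq_bigr => c' _ do
  (rewrite rotationJ//; under eq_bigr do rewrite rotationJ//).
(* Opening four nested two-term sums meets 1 + 2 + 4 + 8 = 15 sums. *)
do 15? rewrite sum_rotation eqxx.
have zero w x y z : ~~ ((w == y) && (x == z) || (w == z) && (x == y)) -> m4 w x y z = 0.
  exact: m4_unbalanced.
have /negbTE ba : b != a by rewrite eq_sym.
move/negbTE: ab => ab.
(* Ten of the sixteen moments are unbalanced. Of the other six, four are the equal arrangements of
   [m4 a b a b], whence the coefficient 4. *)
rewrite (zero a a a b) ?(zero a a b a) ?(zero a a b b) ?(zero a b a a) ?(zero a b b b)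
  ?(zero b a a a) ?(zero b a b b) ?(zero b b a a) ?(zero b b a b) ?(zero b b b a)
  ?eqxx ?ab ?ba//.
rewrite (m4_swapl b a) (m4_swapr a b b a) (m4_swapl b a) (m4_swapr a b b a).
by ring.
Qed.

Lemma m4_offdiag a b : a != b ->
  m4 b b b b = m4 a a a a /\ m4 a b a b = m4 a a a a / 2.
Proof.
move=> ab; have ba : b != a by rewrite eq_sym.
have sJ : conjc (4 / 5 : C) = 4 / 5 by rewrite rmorphM fmorphV !rmorph_nat.
have := m4_rotation ab sJ erefl; have := m4_rotation ba sJ erefl.
rewrite (m4_swapl b a) (m4_swapr a b b a).
move: (m4 a a a a) (m4 b b b b) (m4 a b a b) => x y r.
move=> /eqP; rewrite -subr_eq0 => /eqP e1 /eqP; rewrite -subr_eq0 => /eqP e2.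
have xy : y - x = 0.
  (* Subtracting the relations for [(a, b)] and [(b, a)] eliminates [r] and leaves
     [(800/625) (y - x) = 0]. *)
  transitivity ((625 / 800) * ((y - ((3 / 5) ^+ 4 * y + (4 / 5) ^+ 4 * x + 4 * (3 / 5) ^+ 2 * (4 / 5) ^+ 2 * r))
    - (x - ((3 / 5) ^+ 4 * x + (4 / 5) ^+ 4 * y + 4 * (3 / 5) ^+ 2 * (4 / 5) ^+ 2 * r)))); first by field.
  by rewrite e1 e2 subrr mulr0.
move/eqP: xy; rewrite subr_eq0 => /eqP xy; split => //.
apply/eqP; rewrite eq_sym -subr_eq0; apply/eqP.
(* With [y = x] the relation becomes [(288 x - 576 r) / 625 = 0]. *)
transitivity ((625 / 576) * (x - ((3 / 5) ^+ 4 * x + (4 / 5) ^+ 4 * y + 4 * (3 / 5) ^+ 2 * (4 / 5) ^+ 2 * r))).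
  by rewrite xy; field.
by rewrite e2 mulr0.
Qed.

(** The sum is the expectation of the squared norm, squared. *)
Lemma sum_m4 : \sum_a \sum_b m4 a b a b = 1.
Proof.
transitivity (cexpect P (fun t => \sum_a \sum_b moment4 a b a b (psi t))).
  have b4 a b c e := cbounded_rv_moment4 a b c e cbounded_rv_psi.
  rewrite cexpect_sum => [|a]; last exact: cbounded_rv_sum.
  by apply: eq_bigr => a _; rewrite cexpect_sum.
rewrite -[RHS](cexpect_cst P 1); congr (cexpect P); apply/funext => t.
have n1 : \sum_a psi t a * conjc (psi t a) = 1.
  transitivity ((sqnorm (psi t))%:C%C : C); last by rewrite psi_norm.
  rewrite /sqnorm rmorph_sum; apply: eq_bigr => a _ /=.
  case: (psi t a) => x y; apply/eqP; rewrite eq_complex /=.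
  by apply/andP; split; apply/eqP; ring.
transitivity ((\sum_a psi t a * conjc (psi t a)) * (\sum_a psi t a * conjc (psi t a))); last by rewrite n1 mulr1.
rewrite big_distrl /=; apply: eq_bigr => a _.
by rewrite big_distrr /=; apply: eq_bigr => b _; rewrite /moment4; ring.
Qed.

Lemma m4E a b c e :
  m4 a b c e = ((a == c) && (b == e) + (a == e) && (b == c))%N%:R / (k * k.+1)%:R.
Proof.
(* Defining [q] from a diagonal moment covers [k = 1], where no two coordinates are distinct. *)
pose q := m4 a a a a / 2.
have qE x : m4 x x x x = 2 * q.
  have -> : m4 x x x x = m4 a a a a.
    by have [->//|ax] := eqVneq a x; case: (m4_offdiag ax).
  by rewrite /q; field.
have rE x y : m4 x y x y = (1 + (x == y)%:R) * q.
  have [->|xy] := eqVneq x y; first by rewrite qE.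
  by have [_ ->] := m4_offdiag xy; rewrite qE /=; field.
have k0 : (k * k.+1)%:R != 0 :> C.
  by rewrite pnatr_eq0 -lt0n muln_gt0 /= andbT (leq_ltn_trans (leq0n a)) ?ltn_ord.
have qk : q = 1 / (k * k.+1)%:R.
  apply: (canRL (mulfK k0)); apply: (etrans _ sum_m4).
  (* Each row contributes [k] times [q], and once more on the diagonal. *)
  transitivity (\sum_(x < k) k.+1%:R * q).
    rewrite sumr_const card_ord natrM -[RHS]mulr_natl; move: (k.+1%:R : C) (k%:R : C) => u v; ring.
  apply: eq_bigr => x _; under eq_bigr do rewrite rE mulrDl mul1r.
  rewrite big_split /= sumr_const card_ord -[q *+ k]mulr_natl.
  under eq_bigr do rewrite eq_sym; rewrite sum_delta.
  by rewrite -[in LHS]addn1 natrD mulrDl mul1r.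
have [/orP H|nb] := boolP ((a == c) && (b == e) || (a == e) && (b == c)); last first.
  by rewrite m4_unbalanced//; move: nb; rewrite negb_or => /andP[/negbTE -> /negbTE ->]; rewrite mul0r.
have -> : m4 a b c e = m4 a b a b.
  by case: H => /andP[/eqP <- /eqP <-] //; rewrite m4_swapr.
have -> : ((a == c) && (b == e) + (a == e) && (b == c) = 1 + (a == b))%N.
  by case: H => /andP[/eqP <- /eqP <-]; rewrite !eqxx ?[b == a]eq_sym /= ?andbb// addnC.
by rewrite rE qk mul1r natrD.
Qed.
End Moments.

(** * Purities as sums over pairs of exchanged indices *)

Section Combinatorics.
Variable R : realType.
Local Notation C := R[i].

(* [comb] matches on [idP] with [idP] also occurring in a branch, so that a
   direct case analysis on [idP] is ill-typed. *)
Lemma match_reflect (A : Type) (p : Prop) (b : bool) (r : reflect p b)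
    (f : p -> A) (g : ~ p -> A) (a : A) :
  (forall h, f h = a) -> (forall h, g h = a) ->
  match r with ReflectT h => f h | ReflectF h => g h end = a.
Proof. by case: r. Qed.

Section Mix.
Variables (Q : finType) (d : Q -> nat).

(** The pair [mix S j l], [mix S l j] is [j], [l] with the coordinates outside [S] exchanged: a
    partial swap on two copies of the system. *)
Definition mix (S : {set Q}) (j l : Idx d) : Idx d :=
  [ffun i => if i \in S then j i else l i].

Section Comb.
Variable S : {set Q}.

Lemma comb_in (x : Idx (fun i : inS S => d (val i)))
    (y : Idx (fun i : outS S => d (val i))) i (h : i \in S) :
  comb x y i = x (exist _ i h).
Proof.
rewrite /comb ffunE; apply: match_reflect => h'; last by have := h' h.
by rewrite (bool_irrelevance h' h).
Qed.

Lemma comb_out (x : Idx (fun i : inS S => d (val i)))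
    (y : Idx (fun i : outS S => d (val i))) i (h : i \notin S) :
  comb x y i = y (exist _ i h).
Proof.
rewrite /comb ffunE; apply: match_reflect => h'; first by case/negP: (h).
by rewrite (bool_irrelevance (introN idP h') h).
Qed.

Lemma sum_comb (F : Idx d -> C) :
  \sum_j F j = \sum_(x : Idx (fun i : inS S => d (val i)))
                 \sum_(y : Idx (fun i : outS S => d (val i))) F (comb x y).
Proof.
rewrite pair_bigA /=.
pose h (xy : (Idx (fun i : inS S => d (val i)) * Idx (fun i : outS S => d (val i)))%type) : Idx d :=
  comb xy.1 xy.2.
rewrite (reindex h)//=.
exists (fun j => ([ffun x => j (val x)], [ffun y => j (val y)])).
  move=> [x y] _ /=; congr pair; apply/ffunP => -[i hi]; rewrite ffunE /=.
    exact: comb_in.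
  exact: comb_out.
move=> j _; apply/ffunP => i.
by have [hi|hi] := boolP (i \in S); [rewrite comb_in|rewrite comb_out]; rewrite ffunE.
Qed.

Lemma mix_comb (x x' : Idx (fun i : inS S => d (val i)))
    (y y' : Idx (fun i : outS S => d (val i))) :
  mix S (comb x y) (comb x' y') = comb x y'.
Proof.
apply/ffunP => i; rewrite ffunE; have [h|h] := boolP (i \in S).
  by rewrite !comb_in.
by rewrite !comb_out.
Qed.
End Comb.

(** With [j] and [l] glued from [(x, a)] and [(x', b)], the conjugated entries stand at [(x, b)] and
    [(x', a)], which are the two mixtures. *)
Lemma trsq_ptrace_ketbra (S : {set Q}) (v : Idx d -> C) :
  trsq (@ptrace _ _ _ S (ketbra v)) =
    \sum_j \sum_l moment4 j l (mix S j l) (mix S l j) v.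
Proof.
rewrite /trsq /ptrace /ketbra.
rewrite [RHS](sum_comb S) [RHS]exchange_big /=; apply: eq_bigr => a _.
under [RHS]eq_bigr do rewrite (sum_comb S) exchange_big /=.
rewrite [RHS]exchange_big; apply: eq_bigr => b _ /=.
rewrite big_distrl /=; apply: eq_bigr => x _.
rewrite big_distrr /=; apply: eq_bigr => x' _.
by rewrite !mix_comb /moment4; ring.
Qed.

Lemma moment4_sep (psi : forall i : Q, 'I_(d i) -> C) (a b c e : Idx d) :
  moment4 a b c e (sep_state psi) =
    \prod_i moment4 (a i) (b i) (c i) (e i) (psi i).
Proof. by rewrite /moment4 /sep_state !rmorph_prod -!big_split. Qed.

(* [x] is the set of parties that pair [a] with [c] and [b] with [e] *)
Lemma prod_pairings (a b c e : Idx d) :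
  \prod_i (((a i == c i) && (b i == e i) + (a i == e i) && (b i == c i))%N%:R : C) =
  \sum_(x : {set Q}) (c == mix x a b)%:R * (e == mix x b a)%:R.
Proof.
under eq_bigr do rewrite natrD.
rewrite bigA_distr /=; apply: eq_bigr => x _.
have [-> | cx] := eqVneq c (mix x a b); last first.
  rewrite mul0r; apply/eqP/prodf_eq0.
  have [i ci] : exists i, c i != mix x a b i.
    by apply/existsP; apply: contraNT cx; rewrite negb_exists => /forallP h;
      apply/eqP/ffunP => i; have := h i; rewrite negbK => /eqP.
  exists i => //; move: ci; rewrite ffunE; case: (i \in x); rewrite eq_sym => /negbTE ->//.
  by rewrite andbF.
have [-> | ex] := eqVneq e (mix x b a); last first.
  rewrite mulr0; apply/eqP/prodf_eq0.
  have [i ei] : exists i, e i != mix x b a i.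
    by apply/existsP; apply: contraNT ex; rewrite negb_exists => /forallP h;
      apply/eqP/ffunP => i; have := h i; rewrite negbK => /eqP.
  exists i => //; move: ei; rewrite ffunE; case: (i \in x); rewrite eq_sym => /negbTE ->//.
  by rewrite andbF.
rewrite mulr1 big1// => i _; rewrite !ffunE; by case: (i \in x); rewrite !eqxx.
Qed.
End Mix.

(** * The doubled system and the state associated with a gate *)

Section Doubled.
Variables (Q : finType) (d : Q -> nat).

Definition merge (j k : Idx d) : Idx (ddim d) :=
  [ffun s : Q + Q => match s return 'I_(ddim d s) with inl i => j i | inr i => k i end].

Lemma unprimed_merge j k : unprimed (merge j k) = j.
Proof. by apply/ffunP => i; rewrite !ffunE. Qed.

Lemma primed_merge j k : primed (merge j k) = k.
Proof. by apply/ffunP => i; rewrite !ffunE. Qed.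

Lemma sum_merge (F : Idx (ddim d) -> C) : \sum_J F J = \sum_j \sum_k F (merge j k).
Proof.
pose h (jk : (Idx d * Idx d)%type) := merge jk.1 jk.2.
rewrite pair_bigA /= (reindex h)//=.
exists (fun J => (unprimed J, primed J)).
  by move=> [j k] _; rewrite unprimed_merge primed_merge.
by move=> J _; apply/ffunP => -[i|i]; rewrite !ffunE.
Qed.

Lemma mix_merge (p x : {set Q}) j k l m :
  mix (pxset p x) (merge j k) (merge l m) = merge (mix p j l) (mix x k m).
Proof.
apply/ffunP => -[i|i]; rewrite !ffunE /pxset finset.in_setU.
  rewrite (finset.mem_imset _ _ inl_inj) [X in _ || X](_ : _ = false) ?orbF//.
  by apply/negP => /imsetP[].
rewrite (finset.mem_imset _ _ inr_inj) [X in X || _](_ : _ = false)//.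
by apply/negP => /imsetP[].
Qed.

Lemma trsq_choi_state (p x : {set Q}) (U : oper R d) :
  trsq (@ptrace _ _ _ (pxset p x) (ketbra (choi_state U))) =
  ((\prod_i (d i)%:R) ^- 2)%:C%C *
  \sum_j \sum_l \sum_k \sum_m U j k * (U l m *
     (conjc (U (mix p j l) (mix x k m)) * conjc (U (mix p l j) (mix x m k)))).
Proof.
rewrite trsq_ptrace_ketbra.
rewrite /reverse_coercion.
rewrite sum_merge mulr_sumr; apply: eq_bigr => j _.
rewrite (eq_bigr _ (fun k _ => sum_merge _)) /=.
rewrite exchange_big mulr_sumr; apply: eq_bigr => l _ /=.
rewrite mulr_sumr; apply: eq_bigr => k _.
rewrite mulr_sumr; apply: eq_bigr => m _.
rewrite !mix_merge /moment4 /choi_state !unprimed_merge !primed_merge.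
set D := \prod_i _.
(* Each of the four amplitudes carries one real normalising factor. *)
have -> : D ^- 2 = (Num.sqrt D)^-1 ^+ 4.
  rewrite exprVn -[4%N]/(2 * 2)%N exprM sqr_sqrtr//.
  by apply: prodr_ge0 => i _; exact: ler0n.
move: (Num.sqrt D)^-1 => r.
have rJ : conjc (r%:C : C)%C = (r%:C)%C by rewrite /= oppr0.
rewrite rmorphXn /=; move: (r%:C)%C rJ => z zJ.
by rewrite !(rmorphM conjc) /= zJ; ring.
Qed.
End Doubled.
End Combinatorics.

(** * Averages over random product states and the entangling power *)

Section EntanglingPower.
Context (R : realType) (n : nat) (d : 'I_n -> nat).
Context (dT : measure_display) (T : measurableType dT) (P : probability T R).
Variable psi : forall i : 'I_n, T -> 'I_(d i) -> R[i].
Arguments psi : clear implicits.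
Hypothesis psi_random : random_pure_states P psi.
Local Notation C := R[i].

Let psi_cmeasurable i a : cmeasurable (fun t => psi i t a).
Proof. by case: psi_random => m _ _ _; have [] := m i a. Qed.

Let psi_norm i t : sqnorm (psi i t) = 1.
Proof. by case: psi_random. Qed.

(** The monomial of a product state is a product over the parties; independence separates the
    factors and [m4E] evaluates each. *)
Lemma cexpect_moment4_sep (a b c e : Idx d) :
  cexpect P (fun t => moment4 a b c e (sep_state (fun i => psi i t))) =
  \prod_i ((((a i == c i) && (b i == e i) + (a i == e i) && (b i == c i))%N%:R : C)
           / (d i * (d i).+1)%:R).
Proof.
case: psi_random => _ _ indep inv.
under eq_fun do rewrite moment4_sep.
rewrite (@cexpect_prod_indep _ _ _ _ _ (fun i => coord_system (psi i)) _ 1)//.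
- by apply: eq_bigr => i _; rewrite (m4E (@psi_cmeasurable i) (psi_norm i) (inv i)).
- move=> i.
  by case: (cbounded_rv_moment4 (a i) (b i) (c i) (e i)
              (cbounded_rv_psi (@psi_cmeasurable i) (psi_norm i))).
- move=> i.
  by do 3 (apply: cmeasurableM; first by do ?apply: cmeasurable_conj; exact: cmeasurable_coord);
    apply: cmeasurable_conj; exact: cmeasurable_coord.
move=> i t; rewrite /moment4 !normrM !normcJ.
by do 3 (rewrite mulr_ile1 ?mulr_ge0 //; first exact: normc_coord_le1); exact: normc_coord_le1.
Qed.

Lemma cbounded_rv_sep a : cbounded_rv (fun t => sep_state (fun i => psi i t) a).
Proof.
apply: cbounded_rv_prod => i.
exact: (cbounded_rv_psi (@psi_cmeasurable i) (psi_norm i)).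
Qed.

Lemma cbounded_rv_trsq (U : oper R d) (p : {set 'I_n}) :
  cbounded_rv (fun t => trsq (@ptrace _ _ _ p (ketbra (apply U (sep_state (fun i => psi i t)))))).
Proof.
under eq_fun do rewrite trsq_ptrace_ketbra.
apply: cbounded_rv_sum => j; apply: cbounded_rv_sum => l.
by apply: cbounded_rv_moment4 => x; apply: cbounded_rv_apply; exact: cbounded_rv_sep.
Qed.

(** Expanding the gate and averaging leaves, for each subset [x], deltas that force the conjugated
    input indices to be [mix x k m] and [mix x m k]. This is the summand of [trsq_choi_state]. *)
Lemma cexpect_trsq (U : oper R d) (p : {set 'I_n}) : (forall i, (0 < d i)%N) ->
  cexpect P (fun t => trsq (@ptrace _ _ _ p (ketbra (apply U (sep_state (fun i => psi i t)))))) =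
  (\prod_(i < n) ((d i)%:R / (d i).+1%:R))%:C%C *
  \sum_(x : {set 'I_n}) trsq (@ptrace _ _ _ (pxset p x) (ketbra (choi_state U))).
Proof.
move=> d0.
under eq_fun do rewrite trsq_ptrace_ketbra.
have b4 j l k m : cbounded_rv (fun t =>
    moment4 j l k m (apply U (sep_state (fun i => psi i t)))).
  by apply: cbounded_rv_moment4 => x; apply: cbounded_rv_apply; exact: cbounded_rv_sep.
rewrite cexpect_sum => [|j]; last exact: cbounded_rv_sum.
under eq_bigr do rewrite cexpect_sum//.
pose K : C := \prod_(i < n) (d i * (d i).+1)%:R.
pose G j l k m x := U j k * (U l m *
     (conjc (U (mix p j l) (mix x k m)) * conjc (U (mix p l j) (mix x m k)))).
transitivity (\sum_j \sum_l \sum_k \sum_m \sum_x K^-1 * G j l k m x).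
  apply: eq_bigr => j _; apply: eq_bigr => l _.
  rewrite cexpect_moment4_apply; last exact: cbounded_rv_sep.
  apply: eq_bigr => k _; rewrite mulr_sumr; apply: eq_bigr => m _.
  transitivity (\sum_c \sum_e \sum_x K^-1 * ((c == mix x k m)%:R * ((e == mix x m k)%:R *
     (U j k * (U l m * (conjc (U (mix p j l) c) * conjc (U (mix p l j) e))))))).
    rewrite !mulr_sumr; apply: eq_bigr => c _; rewrite !mulr_sumr; apply: eq_bigr => e _.
    rewrite cexpect_moment4_sep prodf_div prod_pairings -/K !mulr_suml !mulr_sumr.
    by apply: eq_bigr => x _; ring.
  under eq_bigr do rewrite exchange_big.
  rewrite exchange_big; apply: eq_bigr => x _ /=.
  under eq_bigr do rewrite -mulr_sumr -mulr_sumr sum_delta.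
  by rewrite -mulr_sumr sum_delta.
transitivity (\sum_x K^-1 * \sum_j \sum_l \sum_k \sum_m G j l k m x).
  under [RHS]eq_bigr => x _ do (rewrite mulr_sumr; under eq_bigr => j _ do
    (rewrite mulr_sumr; under eq_bigr => l _ do (rewrite mulr_sumr; under eq_bigr => k _ do
      rewrite mulr_sumr))).
  rewrite [RHS]exchange_big; apply: eq_bigr => j _ /=.
  rewrite [RHS]exchange_big; apply: eq_bigr => l _ /=.
  rewrite [RHS]exchange_big; apply: eq_bigr => k _ /=.
  by rewrite [RHS]exchange_big.
rewrite mulr_sumr; apply: eq_bigr => x _.
rewrite trsq_choi_state mulrA -rmorphM /=; congr (_ * _).
(* The squared dimension from normalising the state of the gate turns the factors [d / (d + 1)] into
   the moment constants [1 / (d (d + 1))]. *)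
have -> : \prod_(i < n) ((d i)%:R / (d i).+1%:R) / (\prod_(i < n) (d i)%:R) ^+ 2 =
    (\prod_(i < n) (d i * (d i).+1)%:R)^-1 :> R.
  under [in RHS]eq_bigr do rewrite natrM.
  rewrite prodf_div big_split /=.
  have x0 : \prod_(i < n) (d i)%:R != 0 :> R.
    by apply/prodf_neq0 => i _; rewrite pnatr_eq0 -lt0n.
  have y0 : \prod_(i < n) (d i).+1%:R != 0 :> R.
    by apply/prodf_neq0 => i _; rewrite pnatr_eq0.
  move: (\prod_(i < n) _) (\prod_(i < n) _) x0 y0 => u v u0 v0.
  by field; rewrite u0 v0.
rewrite fmorphV rmorph_prod; congr (_^-1).
by apply: eq_bigr => i _; rewrite rmorph_nat.
Qed.

Section TauIntegral.
Variable U : oper R d.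
Let phi t := apply U (sep_state (fun i => psi i t)).

Lemma integrable_tau_bip p : P.-integrable setT (fun t => (tau_bip p (phi t))%:E).
Proof.
(* Written as the real part of a bounded complex variable, the tangle is integrable. *)
have -> : (fun t => (tau_bip p (phi t))%:E) =
    (fun t => (complex.Re (2 * (1 - trsq (@ptrace _ _ _ p (ketbra (phi t))))))%:E).
  apply/funext => t; rewrite /tau_bip /purity_tr; congr EFin.
  by case: (trsq _) => x y; rewrite /=; ring.
apply: integrable_Re; apply: cbounded_rvZ; apply: cbounded_rvD.
  exact: cbounded_rv_cst.
under eq_fun do rewrite -mulN1r; apply: cbounded_rvZ.
exact: cbounded_rv_trsq.
Qed.

Lemma eps_one_sum :
  (eps_one P psi U = (((2 ^ n.-1 - 1)%:R)^-1)%:E *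
     \sum_(p in bipartitions n) eps_bip P psi U p)%E.
Proof.
rewrite /eps_one /eps_bip /tau_one -integral_sum//; last exact: integrable_tau_bip.
rewrite -integralZl//.
  by apply: eq_integral => t _; rewrite EFinM sumEFin.
by apply: integrable_sum => // p _; exact: integrable_tau_bip.
Qed.

Lemma eps_bipE p : (forall i, (0 < d i)%N) ->
  eps_bip P psi U p =
    (2 * (1 - (\prod_(i < n) ((d i)%:R / (d i).+1%:R)) *
              \sum_(x : {set 'I_n}) purity_tr (pxset p x) (choi_state U)))%:E.
Proof.
move=> d0.
have iX : P.-integrable setT (EFin \o (fun t => purity_tr p (phi t))).
  exact: (integrable_Re P (cbounded_rv_trsq U p)).
have i1 : P.-integrable setT (EFin \o (fun=> 1 : R)).
  exact: finite_measure_integrable_cst.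
have iD : P.-integrable setT (EFin \o (fun t => 1 - purity_tr p (phi t))).
  exact: (integrableB measurableT i1 iX).
have EX : \int[P]_t purity_tr p (phi t) =
    \prod_(i < n) ((d i)%:R / (d i).+1%:R) *
      \sum_(x : {set 'I_n}) purity_tr (pxset p x) (choi_state U).
  (* The prefactor is real, so taking real parts turns each trace on the right into a purity. *)
  have := congr1 (@complex.Re R) (cexpect_trsq U p d0).
  rewrite ReM /= mul0r subr0 => ->; congr (_ * _).
  by elim/big_ind2: _ => [//|x1 x2 y1 y2 <- <-|//]; rewrite ReD.
rewrite -EX /eps_bip.
(* The integral is finite, so the computation can move from extended reals to reals. *)
transitivity ((\int[P]_t (2 * (1 - purity_tr p (phi t))))%:E).
  rewrite /Rintegral fineK//; apply: integrable_fin_num => //.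
  exact: integrable_tau_bip.
rewrite RintegralZl// RintegralB// Rintegral_cst//.
by rewrite mul1r [X in fine X](@probability_setT _ _ _ P).
Qed.
End TauIntegral.
End EntanglingPower.

Theorem theorem4 (R : realType) (n : nat) (d : 'I_n -> nat)
  (dT : measure_display) (T : measurableType dT) (Pr : probability T R)
  (psi : forall i : 'I_n, T -> 'I_(d i) -> R[i]) (U : @oper R _ d) :
  (1 < n)%N -> (forall i, (0 < d i)%N) ->
  unitary U ->
  random_pure_states Pr psi ->
  (eps_one Pr psi U =
     (((2 ^ n.-1 - 1)%:R)^-1)%:E * \sum_(p in bipartitions n) eps_bip Pr psi U p)%E
  /\ (forall p : {set 'I_n}, p \in bipartitions n ->
      eps_bip Pr psi U p =
        (2 * (1 - (\prod_(i < n) ((d i)%:R / (d i).+1%:R)) *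
                  \sum_(x' : {set 'I_n}) purity_tr (pxset p x') (choi_state U)))%:E).
Proof.
move=> _ d0 _ random; split; first exact: eps_one_sum.
by move=> p _; exact: eps_bipE.
Qed.
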